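(* Let $N$ be a positive integer and let $0<\beta<1/(N+1)$. Let $\Gamma\subset\mathbb{R}$ be the unique non-empty compact set with $\Gamma=\bigcup_{i=0}^N\phi_i(\Gamma)$, where $\phi_i(x)=\beta x+i\frac{1-\beta}{N}$. Then for every positive integer $m$ there exist infinitely many vectors $\mathbf{t}=(t_0,t_1,\ldots,t_m)\in\mathbb{R}^{m+1}$ with $0=t_0<t_1<\cdots<t_m$ such that $\Gamma_{\mathbf{t}}=\bigcup_{j=0}^m(\Gamma+t_j)$ is a self-similar set.
   Context: A non-empty compact set $E\subset\mathbb{R}$ is called a self-similar set if there is a finite set of contractive similitudes $\{f_1,\ldots,f_n\}$ of $\mathbb{R}$ (maps $f_i(x)=r_ix+b_i$ with $0<|r_i|<1$, $b_i\in\mathbb{R}$; negative ratios are allowed) such that $E=\bigcup_{i=1}^n f_i(E)$. For $X\subset\mathbb{R}$ and $b\in\mathbb{R}$, $X+b=\{x+b:x\in X\}$. *)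

(* Defs.v *)
From HB Require Import structures.
From mathcomp Require Import all_boot all_order all_algebra.
From mathcomp Require Import all_classical all_reals all_analysis.
Set Implicit Arguments.
Unset Strict Implicit.
Unset Printing Implicit Defensive.
Import Order.TTheory GRing.Theory Num.Theory.
Import numFieldNormedType.Exports.
Local Open Scope classical_set_scope.
Local Open Scope ring_scope.

Definition contractive_similitude (R : realType) (f : R -> R) : Prop :=
  exists r b : R, [/\ 0 < `|r|, `|r| < 1 & forall x, f x = r * x + b].

Definition invariant_under (R : realType) (n : nat) (f : 'I_n -> R -> R)
    (E : set R) : Prop :=
  E = \bigcup_(i in [set: 'I_n]) (f i @` E).

Definition self_similar (R : realType) (E : set R) : Prop :=
  [/\ E !=set0, compact E &
      exists (n : nat) (f : 'I_n -> R -> R),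
        (forall i, contractive_similitude (f i)) /\ invariant_under f E].

Definition phi (R : realType) (N : nat) (beta : R) (i : 'I_N.+1) (x : R) : R :=
  beta * x + i%:R * ((1 - beta) / N%:R).

Definition translate (R : realType) (X : set R) (b : R) : set R :=
  [set x + b | x in X].

Definition union_translates (R : realType) (X : set R) (m : nat)
    (t : 'rV[R]_m.+1) : set R :=
  \bigcup_(j in [set: 'I_m.+1]) translate X (t 0 j).

(* Main.v *)
Require Import Defs.
From HB Require Import structures.
From mathcomp Require Import all_boot all_order all_algebra.
From mathcomp Require Import all_classical all_reals all_analysis.
From mathcomp Require Import ring lra.
Set Implicit Arguments.
Unset Strict Implicit.
Unset Printing Implicit Defensive.
Import Order.TTheory GRing.Theory Num.Theory.
Import numFieldNormedType.Exports.
Local Open Scope classical_set_scope.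
Local Open Scope ring_scope.

(** Write d = (1 - beta) / N, so that Gamma = beta Gamma + {0, d, ..., N d}.

    Fix q and let a_i = d / beta^(q+i+1).  Let T be the set of the 2^j subset
    sums of a_0, ..., a_(j-1), and C = Gamma + T.

    - C is a magnified part of Gamma: Gamma is a finite union of translates of
      beta^(q+j) C ([union_of_copies_sumset]).  Passing from j-1 to j turns C
      into C u (C + a_(j-1)); at scale beta^(q+j) this shift has length
      exactly d, the distance between neighbouring first-level pieces of
      Gamma, and since N >= 1 these pieces can be grouped (with overlaps) into
      neighbouring pairs ([union_of_copies_double]).

    - Since 1/beta > 2, each a_i exceeds the sum of the previous ones, so
      binary counting lists T in increasing order; also T is symmetric.  Take for t its m+1 smallest elements,
      where 2^(j-1) < m+1 <= 2^j.  As t contains at least half of T, the set T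
      is the union of t and a reflected copy of t.  Now Gamma is symmetric as
      well, x |-> 1 - x mapping it to an invariant compact set
      ([attractor_symmetric]).  Therefore C is the union of E = Gamma + t and
      of a reflected copy of E ([sumset_take_reflect]).

    Hence E is a finite union of translates of Gamma, each of which is a finite
    union of contracted copies of C, each of which is a union of one copy of E
    and one reflected copy of E: the set E is self-similar
    ([self_similar_sumset]).  Different q give different vectors t, because
    t_1 = a_0 = d / beta^(q+1). *)

(** * Uniqueness of attractors *)

(** A point of [A] lies in [k]-th level images of points of [A]; following the
    same maps from [b0] gives a point of [B] at distance at most
    [c ^+ k * K], so [A] lies in the closure of [B]. *)
Lemma invariant_subset (R : realType) (n : nat) (f : 'I_n -> R -> R) (c : R)
    (A B : set R) :
  0 <= c -> c < 1 -> (forall i x y, `|f i x - f i y| <= c * `|x - y|) ->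
  compact A -> invariant_under f A ->
  B !=set0 -> compact B -> invariant_under f B ->
  A `<=` B.
Proof.
move=> c0 c1 flip Aco Ainv [b0 Bb0] Bco Binv.
have [M [_ MA]] := compact_bounded Aco.
have {}MA a : A a -> `|a| <= `|M| + 1.
  by apply: MA; rewrite (le_lt_trans (ler_norm _))// ltrDl.
pose K := `|M| + 1 + `|b0|.
have approx k a : A a -> exists2 b, B b & `|a - b| <= c ^+ k * K.
  elim: k a => [|k IHk] a Aa.
    exists b0 => //; rewrite expr0 mul1r (le_trans (ler_normB _ _))//.
    by rewrite lerD2r MA.
  move: Aa; rewrite Ainv => -[i _ [a' /IHk[b Bb a'b] <-]].
  exists (f i b); first by rewrite Binv; exists i => //; exists b.
  by rewrite (le_trans (flip _ _ _))// exprS -mulrA ler_wpM2l.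
move=> a Aa.
have /closure_id -> : closed B by apply: compact_closed.
move=> U /nbhs_ballP[e /= e0 eU].
have /cvgr_norm_lt/(_ e) : (fun k => c ^+ k * K) @ \oo --> (0 : R).
  rewrite -[X in _ --> X](mul0r K); apply: cvgMl.
  by apply: cvg_expr; rewrite ger0_norm.
rewrite normr0 => /(_ e0)[k _ /(_ k (leqnn _))] /= ke.
have [b Bb ab] := approx k a Aa; exists b; split=> //; apply: eU.
by rewrite /ball/= (le_lt_trans ab)// (le_lt_trans (ler_norm _) ke).
Qed.

Lemma phi_lipschitz (R : realType) (N : nat) (beta : R) (i : 'I_N.+1) x y :
  0 < beta -> `|phi beta i x - phi beta i y| <= beta * `|x - y|.
Proof.
move=> b0; rewrite /phi opprD addrACA subrr addr0 -mulrBr normrM.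
by rewrite gtr0_norm.
Qed.

Lemma phi_reflect (R : realType) (N : nat) (beta : R) (i : 'I_N.+1) x :
  (0 < N)%N -> phi beta (rev_ord i) (1 - x) = 1 - phi beta i x.
Proof.
move=> N0; rewrite /phi /= subSS natrB -1?ltnS//.
by field; rewrite pnatr_eq0 -lt0n.
Qed.

(** The reflection [x |-> 1 - x] exchanges [phi i] and [phi (N - i)], so the
    reflected attractor is again compact and invariant. *)
Lemma attractor_symmetric (R : realType) (N : nat) (beta : R) (Gamma : set R) :
  (0 < N)%N -> 0 < beta -> beta < 1 ->
  Gamma !=set0 -> compact Gamma -> invariant_under (@phi R N beta) Gamma ->
  forall x, Gamma x -> Gamma (1 - x).
Proof.
move=> N0 b0 b1 G0 Gco Ginv.
suff sub : [set 1 - x | x in Gamma] `<=` Gamma.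
  by move=> x Gx; apply: sub; exists x.
apply: (@invariant_subset R _ (@phi R N beta) beta) => //.
- exact: ltW.
- by move=> i x y; exact: phi_lipschitz.
- apply: continuous_compact => //; apply: continuous_subspaceT => x.
  by apply: cvgB; exact: cvg_cst || exact: cvg_id.
apply/seteqP; split=> [_ [x + <-]|y [i _ [_ [x Gx <-] <-]]].
  rewrite {1}Ginv => -[i _ [z Gz <-]]; exists (rev_ord i) => //.
  by exists (1 - z); [exists z|exact: phi_reflect].
exists (phi beta (rev_ord i) x).
  by rewrite Ginv; exists (rev_ord i) => //; exists x.
by rewrite -phi_reflect// rev_ordK.
Qed.

(** * Subset sums *)

(** Listed by binary counting: the entry of index [n] is the sum of the [a i]
    over the binary digits [1] of [n], with repetitions kept.  Both the
    symmetry and the monotonicity of the list depend on this order. *)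
Fixpoint subset_sums (R : realType) (a : nat -> R) (j : nat) : seq R :=
  if j is k.+1 then
    subset_sums a k ++ [seq s + a k | s <- subset_sums a k]
  else [:: 0].

Lemma size_subset_sums (R : realType) (a : nat -> R) j :
  size (subset_sums a j) = (2 ^ j)%N.
Proof.
by elim: j => //= j IHj; rewrite size_cat size_map IHj addnn -mul2n expnS.
Qed.

(** Complementing a subset turns the sum [s] into [c - s], where [c] is the sum
    of all terms, and it reverses binary counting. *)
Lemma rev_subset_sums (R : realType) (a : nat -> R) j :
  exists c, rev (subset_sums a j) = [seq c - s | s <- subset_sums a j].
Proof.
elim: j => [|j [c IHj]] /=; first by exists 0; rewrite subr0.
exists (c + a j); rewrite rev_cat -map_rev IHj map_cat -!map_comp.
by congr (_ ++ _); apply: eq_map => s /=; ring.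
Qed.

(** The doubling condition makes [a j] exceed the sum [c] of all previous terms,
    so the second half of the list lies beyond the first half.  The bound [c]
    is part of the conclusion because the induction needs it. *)
Lemma subset_sums_sorted (R : realType) (a : nat -> R) j :
  0 < a 0%N -> (forall i, 2 * a i <= a i.+1) ->
  sorted <%R (subset_sums a j) /\
  exists2 c, c < a j & all (fun s => 0 <= s <= c) (subset_sums a j).
Proof.
move=> a0 a2; rewrite (sorted_pairwise lt_trans).
have apos i : 0 < a i by elim: i => // i IHi; have := a2 i; lra.
elim: j => [|j [srt [c caj /allP bnd]]] /=.
  by split=> //; exists 0 => //; rewrite !lexx.
split.
  rewrite pairwise_cat srt pairwise_map /=; apply/andP; split.
    apply/allrelP => s t /bnd/andP[_ sc] /mapP[t' /bnd/andP[t0 _] ->].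
    by rewrite (le_lt_trans sc)// (lt_le_trans caj)// lerDr.
  by apply: sub_pairwise srt => x y /=; rewrite ltrD2r.
exists (c + a j); first by have := a2 j; lra.
apply/allP => s; rewrite mem_cat => /orP[/bnd/andP[s0 sc]|].
  by rewrite s0 (le_trans sc)// lerDl ltW.
move=> /mapP[t /bnd/andP[t0 tc] ->].
by rewrite lerD2r tc addr_ge0// ltW.
Qed.

Lemma nth0_subset_sums (R : realType) (a : nat -> R) j :
  nth 0 (subset_sums a j) 0 = 0.
Proof. by elim: j => //= j IHj; rewrite nth_cat size_subset_sums expn_gt0. Qed.

Lemma nth1_subset_sums (R : realType) (a : nat -> R) j :
  nth 0 (subset_sums a j.+1) 1 = a 0%N.
Proof.
elim: j => [|j IHj]; first by rewrite /= add0r.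
set u := subset_sums a j.+1 in IHj *.
rewrite -[LHS]/(nth 0 (u ++ [seq s + a j.+1 | s <- u]) 1) nth_cat.
by rewrite size_subset_sums -{1}(expn0 2) ltn_exp2l.
Qed.

(** * Finite unions of similar copies *)

Definition sumset (R : realType) (X T : set R) : set R :=
  [set x + s | x in X & s in T].

Lemma compact_sumset (R : realType) (X T : set R) :
  compact X -> compact T -> compact (sumset X T).
Proof.
move=> Xco Tco.
have -> : sumset X T = (fun p : R * R => p.1 + p.2) @` (X `*` T).
  apply/seteqP; split=> [_ [x Xx [s Ts <-]]|_ [[x s] [Xx Ts] <-]].
    by exists (x, s).
  by exists x => //; exists s.
apply: continuous_compact; last exact: compact_setX.
by apply: continuous_subspaceT; exact: add_continuous.
Qed.

Definition union_of_copies (R : realType) (lambda : R) (X Y : set R) : Prop :=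
  exists2 B, finite_set B & Y = [set lambda * x + b | x in X & b in B].

Lemma union_of_copies_phi (R : realType) (N : nat) (beta lambda : R)
    (Gamma X : set R) :
  invariant_under (@phi R N beta) Gamma ->
  union_of_copies lambda X Gamma ->
  union_of_copies (beta * lambda) X Gamma.
Proof.
move=> Ginv [B Bfin GB].
exists [set beta * b + i%:R * ((1 - beta) / N%:R) | b in B & i in [set: 'I_N.+1]].
  exact: finite_image2.
rewrite {1}Ginv; apply/seteqP; split=> [_ [i _ [y + <-]]|].
  rewrite {1}GB => -[x Xx [b Bb <-]].
  exists x => //; exists (beta * b + i%:R * ((1 - beta) / N%:R)).
    by exists b => //; exists i.
  by rewrite /phi; ring.
move=> _ [x Xx [_ [b Bb [i _ <-]] <-]]; exists i => //.
exists (lambda * x + b); first by rewrite {1}GB; exists x => //; exists b.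
by rewrite /phi; ring.
Qed.

(** The hypothesis on [a] says that shifting [X] by [a] moves the small copies
    of [X] from one first-level piece of [Gamma] onto the next one.  Hence the
    copies in the pieces [i] and [i.+1] combine into copies of
    [X `|` translate X a]. *)
Lemma union_of_copies_double (R : realType) (N : nat) (beta lambda a : R)
    (Gamma X : set R) :
  (0 < N)%N -> invariant_under (@phi R N beta) Gamma ->
  beta * lambda * a = (1 - beta) / N%:R ->
  union_of_copies lambda X Gamma ->
  union_of_copies (beta * lambda) (X `|` translate X a) Gamma.
Proof.
move=> N0 Ginv aE [B Bfin GB].
exists [set beta * b + i%:R * ((1 - beta) / N%:R) | b in B & i in [set: 'I_N]].
  exact: finite_image2.
have Gin (i : nat) x b : (i < N.+1)%N -> X x -> B b ->
    Gamma (beta * lambda * x + (beta * b + i%:R * ((1 - beta) / N%:R))).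
  move=> iN Xx Bb; rewrite Ginv; exists (Ordinal iN) => //.
  exists (lambda * x + b); first by rewrite {1}GB; exists x => //; exists b.
  by rewrite /phi /=; ring.
apply/seteqP; split=> [y|]; last first.
  move=> _ [x Xx [_ [b Bb [i _ <-]] <-]]; case: Xx => [Xx|[x' Xx' <-]].
    by apply: Gin => //; rewrite ltnW// ltnS.
  have := Gin i.+1 x' b (ltn_ord i) Xx' Bb; rewrite -aE -natr1.
  by congr (Gamma _); ring.
rewrite {1}Ginv => -[i _ [z + <-]]; rewrite {1}GB => -[x Xx [b Bb <-]].
(* The last piece is only ever the upper member of a pair, so it is reached
   through the shifted half, from the piece of index [N.-1]. *)
case: (ltnP i N) => iN.
  exists x; first by left.
  exists (beta * b + i%:R * ((1 - beta) / N%:R)); last by rewrite /phi; ring.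
  by exists b => //; exists (Ordinal iN).
have iE : i = N :> nat by apply/eqP; rewrite eqn_leq iN -ltnS ltn_ord.
exists (x + a); first by right; exists x.
have N1 : (N.-1 < N)%N by rewrite prednK.
exists (beta * b + N.-1%:R * ((1 - beta) / N%:R)).
  by exists b => //; exists (Ordinal N1).
have NE : N%:R = N.-1%:R + 1 :> R by rewrite natr1 prednK.
by rewrite /phi iE -aE NE; ring.
Qed.

(** For [j = 0] this is the [q]-fold iteration of the invariance of [Gamma];
    each further term of [a] costs one doubling. *)
Lemma union_of_copies_sumset (R : realType) (N : nat) (beta : R) (a : nat -> R)
    (q j : nat) (Gamma : set R) :
  (0 < N)%N -> invariant_under (@phi R N beta) Gamma ->
  (forall i, beta ^+ (q + i).+1 * a i = (1 - beta) / N%:R) ->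
  union_of_copies (beta ^+ (q + j))
    (sumset Gamma [set` subset_sums a j]) Gamma.
Proof.
move=> N0 Ginv aE; elim: j => [|j IHj].
  rewrite addn0; have -> : sumset Gamma [set` subset_sums a 0] = Gamma.
    apply/seteqP; split=> [_ [x Gx [s + <-]]|x Gx].
      by rewrite /= inE => /eqP ->; rewrite addr0.
    by exists x => //; exists 0; rewrite ?addr0//= inE.
  elim: q {aE} => [|q IHq].
    exists [set 0]; first exact: finite_set1.
    apply/seteqP; split=> [x Gx|_ [x Gx [_ -> <-]]].
      by exists x => //; exists 0 => //; rewrite expr0 mul1r addr0.
    by rewrite expr0 mul1r addr0.
  by rewrite exprS; exact: union_of_copies_phi Ginv IHq.
rewrite addnS exprS.
have -> : sumset Gamma [set` subset_sums a j.+1] =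
    sumset Gamma [set` subset_sums a j] `|`
    translate (sumset Gamma [set` subset_sums a j]) (a j).
  apply/seteqP; split.
    move=> _ [x Gx [s + <-]]; rewrite /= mem_cat => /orP[sT|/mapP[t tT ->]].
      by left; exists x => //; exists s.
    by right; exists (x + t); [exists x => //; exists t|rewrite addrA].
  move=> _ [[x Gx [s sT <-]]|[_ [x Gx [s sT <-]] <-]]; exists x => //.
    by exists s => //=; rewrite mem_cat sT.
  by exists (s + a j); rewrite ?addrA//= mem_cat; apply/orP; right;
  exact: (map_f (+%R^~ (a j))).
by apply: (union_of_copies_double N0 Ginv) => //; rewrite -exprS aE.
Qed.

Lemma self_similar_of_finite_set (R : realType) (E : set R)
    (P : set (R * R)) :
  E !=set0 -> compact E -> finite_set P ->
  (forall p, P p -> 0 < `|p.1| < 1) ->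
  E = [set p.1 * x + p.2 | p in P & x in E] -> self_similar E.
Proof.
move=> E0 Eco /finite_seqP[s Ps] Pr EP; split => //.
exists (size s), (fun i x => (nth 0 s i).1 * x + (nth 0 s i).2); split.
  move=> i; exists (nth 0 s i).1, (nth 0 s i).2; split=> //;
  by have /Pr/andP[] : P (nth 0 s i) by rewrite Ps /= mem_nth.
rewrite /invariant_under {1}EP; apply/seteqP; split=> [_ [p + [x Ex <-]]|].
  rewrite Ps /= => /(nthP 0)[i si <-]; exists (Ordinal si) => //.
  by exists x.
move=> _ [i _ [x Ex <-]]; exists (nth 0 s i); last by exists x.
by rewrite Ps /= mem_nth.
Qed.

(** A translate of [Gamma] splits into contracted copies of [C], and a copy of
    [C] splits into one copy of [sumset Gamma T] and one reflected copy, the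
    latter of ratio [- lambda]. *)
Lemma self_similar_sumset (R : realType) (lambda c : R) (Gamma T C : set R) :
  0 < lambda -> lambda < 1 -> Gamma !=set0 -> compact (sumset Gamma T) ->
  T !=set0 -> finite_set T ->
  C = sumset Gamma T `|` [set c - x | x in sumset Gamma T] ->
  union_of_copies lambda C Gamma ->
  self_similar (sumset Gamma T).
Proof.
move=> l0 l1 [g Gg] Eco [t0 Tt0] Tfin CE [B Bfin GB].
pose D := [set b + t | b in B & t in T].
have Dfin : finite_set D by exact: finite_image2.
apply: (@self_similar_of_finite_set _ _
  ([set (lambda, b) | b in D] `|` [set (- lambda, lambda * c + b) | b in D])).
- by exists (g + t0); exists g => //; exists t0.
- exact: Eco.
- by rewrite finite_setU; split; exact: finite_image.
- by move=> _ [[b _ <-]|[b _ <-]] /=; rewrite ?normrN gtr0_norm// l0 l1.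
apply/seteqP; split.
  move=> _ [y + [t Tt <-]]; rewrite {1}GB => -[w Cw [b Bb <-]].
  move: Cw; rewrite CE => -[Ew|[z Ez <-]].
    exists (lambda, b + t); last by exists w => //=; rewrite addrA.
    by left; exists (b + t) => //; exists b => //; exists t.
  exists (- lambda, lambda * c + (b + t)).
    by right; exists (b + t) => //; exists b => //; exists t.
  by exists z => //=; ring.
have CG z b t : C z -> B b -> T t -> sumset Gamma T (lambda * z + (b + t)).
  move=> Cz Bb Tt; rewrite addrA; exists (lambda * z + b); last by exists t.
  by rewrite GB; exists z => //; exists b.
move=> _ [p + [x Ex <-]].
move=> [[_ [b Bb [t Tt <-]] <-]|[_ [b Bb [t Tt <-]] <-]] /=.
  by apply: CG => //; rewrite CE; left.
rewrite (_ : _ + _ = lambda * (c - x) + (b + t)); last by ring.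
by apply: CG => //; rewrite CE; right; exists x.
Qed.

(** The reflection [s |-> c - s] reverses the list [T], so it maps the entries
    missing from [take n T] to entries among the first [size T - n], which is
    at most [n]. *)
Lemma sumset_take_reflect (R : realType) (Gamma : set R) (T : seq R)
    (c : R) (n : nat) :
  (forall x, Gamma x -> Gamma (1 - x)) ->
  rev T = [seq c - s | s <- T] -> (size T <= n.*2)%N ->
  sumset Gamma [set` T] = sumset Gamma [set` take n T] `|`
    [set 1 + c - x | x in sumset Gamma [set` take n T]].
Proof.
move=> Gsym revT sizeT.
have memT s : s \in T -> c - s \in T.
  by move=> sT; rewrite -mem_rev revT; exact: (map_f (fun s => c - s)).
apply/seteqP; split=> [_ [x Gx [s sT <-]]|].
  move: sT; rewrite /= -{1}(cat_take_drop n T) mem_cat => /orP[sT|sT].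
    by left; exists x => //; exists s.
  right; exists (1 - x + (c - s)); last by ring.
  exists (1 - x); first exact: Gsym.
  exists (c - s) => //=.
  have : c - s \in [seq c - s | s <- drop n T] by exact: (map_f (fun s => c - s)).
  rewrite map_drop -revT -{1}(cat_take_drop n T) rev_cat drop_cat size_rev.
  rewrite size_drop ltnNge leq_subLR addnn sizeT /= => /mem_drop.
  by rewrite mem_rev.
move=> _ [[x Gx [s sT <-]]|[_ [x Gx [s sT <-]] <-]].
  by exists x => //; exists s => //; exact: mem_take sT.
exists (1 - x); first exact: Gsym.
by exists (c - s); [exact: memT (mem_take sT)|ring].
Qed.

Theorem theorem1p1 (R : realType) (N : nat) (beta : R) (Gamma : set R)
    (N_gt0 : (0 < N)%N)
    (beta_gt0 : 0 < beta) (beta_lt : beta < 1 / (N%:R + 1))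
    (Gamma_neq0 : Gamma !=set0) (Gamma_compact : compact Gamma)
    (Gamma_inv : invariant_under (@phi R N beta) Gamma)
    (m : nat) (m_gt0 : (0 < m)%N) :
  infinite_set [set t : 'rV[R]_m.+1 |
    [/\ t 0 0 = 0,
        (forall i j : 'I_m.+1, (i < j)%N -> t 0 i < t 0 j) &
        self_similar (union_translates Gamma t)]].
Proof.
have N1 : 1 <= N%:R :> R by rewrite ler1n.
have bhalf : beta < 2^-1.
  apply: lt_le_trans beta_lt _; rewrite div1r lef_pV2 ?posrE; lra.
have b1 : beta < 1 by lra.
pose d := (1 - beta) / N%:R.
have d0 : 0 < d by rewrite divr_gt0 ?ltr0n// subr_gt0.
(* The full list of sums will have [2 ^ j.+1] entries: at least [m.+1], so that
   [m.+1] of them can be taken, and at most twice as many, so that these and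
   their reflections fill the list. *)
have [j m2j j2m] : exists2 j, (m.+1 <= 2 ^ j.+1)%N & (2 ^ j.+1 <= m.+1.*2)%N.
  have /andP[lo hi] : (2 ^ (up_log 2 m.+1).-1 < m.+1 <= 2 ^ up_log 2 m.+1)%N.
    by apply: up_log_bounds; rewrite ?ltnS.
  have ul0 : (0 < up_log 2 m.+1)%N by rewrite up_log_gt0.
  exists (up_log 2 m.+1).-1; rewrite ?prednK//.
  by rewrite -(prednK ul0) expnS mul2n leq_double ltnW.
(* The exponent is such that, at the scale [beta ^+ (q + i).+1] of the
   [i]-th doubling, [a q i] shrinks to [d]. *)
pose a q i : R := d / beta ^+ (q + i).+1.
have aE q i : beta ^+ (q + i).+1 * a q i = d.
  by rewrite mulrC divfK// expf_neq0// gt_eqF.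
have a0 q i : 0 < a q i by rewrite divr_gt0// exprn_gt0.
have a2 q i : 2 * a q i <= a q i.+1.
  have -> : a q i = beta * a q i.+1.
    by rewrite /a addnS [in RHS]exprS invfM mulrCA mulVKf// gt_eqF.
  by rewrite mulrA ler_piMl ?(ltW (a0 _ _))//; lra.
pose T q := subset_sums (a q) j.+1.
pose t q : 'rV[R]_m.+1 := \row_(n < m.+1) nth 0 (T q) n.
have sizeT q : size (T q) = (2 ^ j.+1)%N by exact: size_subset_sums.
have tE q : union_translates Gamma (t q) = sumset Gamma [set` take m.+1 (T q)].
  apply/seteqP; split=> [_ [i _ [x Gx <-]]|_ [x Gx [s + <-]]].
    exists x => //; exists (t q 0 i) => //=.
    rewrite mxE -(nth_take _ (ltn_ord i)) mem_nth// size_takel ?sizeT//.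
  move=> /(nthP 0)[i]; rewrite size_takel ?sizeT// => im <-.
  by exists (Ordinal im) => //; exists x => //; rewrite mxE /= nth_take.
suff tq q : [/\ t q 0 0 = 0,
    (forall i j : 'I_m.+1, (i < j)%N -> t q 0 i < t q 0 j) &
    self_similar (union_translates Gamma (t q))].
  apply/infiniteP/pcard_leP/injfunPex; exists t; first by move=> q _; exact: tq.
  move=> p q _ _ /rowP tpq.
  have m1 : (1 < m.+1)%N by rewrite ltnS.
  move: (tpq (Ordinal m1)); rewrite !mxE /= !nth1_subset_sums.
  rewrite /a !addn0 => /(mulfI (lt0r_neq0 d0))/invr_inj.
  by move=> /(ieexprIn beta_gt0 (negbT (lt_eqF b1)))[].
split.
- by rewrite mxE nth0_subset_sums.
- move=> i k ik; rewrite !mxE.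
  have [srt _] := subset_sums_sorted j.+1 (a0 q 0%N) (a2 q).
  by rewrite (lt_sorted_ltn_nth 0 srt) ?inE// sizeT (leq_trans (ltn_ord _)).
have [c revT] := rev_subset_sums (a q) j.+1.
have Tfin : finite_set [set` take m.+1 (T q)] by exact: finite_seq.
rewrite tE.
apply: (@self_similar_sumset _ (beta ^+ (q + j.+1)) (1 + c) _ _
  (sumset Gamma [set` T q])) => //.
- exact: exprn_gt0.
- by rewrite exprn_ilt1 ?ltW// addnS.
- by apply: compact_sumset => //; exact: finite_compact.
- by exists 0 => /=; rewrite -(nth0_subset_sums (a q) j.+1)
    -(nth_take (n0:=m.+1))// mem_nth// size_takel ?sizeT.
- apply: sumset_take_reflect => //; last by rewrite sizeT.
  exact: attractor_symmetric Gamma_inv.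
- exact: union_of_copies_sumset N_gt0 Gamma_inv (aE q).
Qed.
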